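(* Let $a, b$ be integers with $3 \leq a \leq b$. Then $\mathcal{G}_{\mathcal{E}}(a,b) \geq b - 2a + 1$.
   Context: A position is an unordered pair $(a,b)$ of nonnegative integers (pile sizes). $\mathcal{E}$-Wythoff: a move either removes a positive number of tokens from one pile, or removes the same positive number of tokens from both piles, or removes $k$ tokens from the smaller pile (or from either pile if the piles are equal) and $l$ tokens from the other pile, for integers $k \geq 1$, $l\ge 0$ with $l < k$. $\mathcal{G}_{\mathcal{E}}$ is its Sprague-Grundy function: $\mathcal{G}_{\mathcal{E}}(p)=\mathrm{mex}\{\mathcal{G}_{\mathcal{E}}(q): q \text{ reachable from } p \text{ in one move}\}$, where $\mathrm{mex}(S)$ is the least nonnegative integer not in $S$ and $\mathrm{mex}\{\}=0$. *)

(* Defs.v *)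
From mathcomp Require Import all_boot.

Set Implicit Arguments.
Unset Strict Implicit.
Unset Printing Implicit Defensive.

(* Unordered pairs of pile sizes, represented by the sorted pair. *)
Definition position := {p : nat * nat | p.1 <= p.2}.

Lemma pos_subproof a b : (minn a b, maxn a b).1 <= (minn a b, maxn a b).2.
Proof. by rewrite /= geq_min !leq_max !leqnn. Qed.

Definition pos (a b : nat) : position :=
  exist _ (minn a b, maxn a b) (pos_subproof a b).

Definition smaller (p : position) : nat := (val p).1.
Definition larger (p : position) : nat := (val p).2.
Definition tokens (p : position) : nat := smaller p + larger p.

Lemma posC a b : pos a b = pos b a.
Proof. by apply: val_inj; rewrite /= minnC maxnC. Qed.

Lemma posK p : pos (smaller p) (larger p) = p.
Proof.
by case: p => -[a b] ab; apply: val_inj; rewrite /= (minn_idPl ab) (maxn_idPr ab).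
Qed.

Lemma smaller_pos a b : a <= b -> smaller (pos a b) = a.
Proof. by move/minn_idPl. Qed.

Lemma larger_pos a b : a <= b -> larger (pos a b) = b.
Proof. by move/maxn_idPr. Qed.

Lemma tokens_pos a b : tokens (pos a b) = a + b.
Proof. exact: addn_min_max. Qed.

(* The position [p] may be read as either of [pos x y] and [pos y x], so that
   in each clause [x] is any pile allowed by the rule; in the last one the
   condition [x <= y] permits both readings exactly when the piles are equal. *)
Definition move (p q : position) : Prop :=
  exists x y : nat, p = pos x y /\
    [\/ exists k, [/\ 1 <= k, k <= x & q = pos (x - k) y],
        exists k, [/\ 1 <= k, k <= x, k <= y & q = pos (x - k) (y - k)]
      | x <= y /\ exists k l,
          [/\ 1 <= k, k <= x, l < k, l <= y & q = pos (x - k) (y - l)]].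

Definition options (p : position) : seq position :=
  let a := smaller p in let b := larger p in
  [seq pos (a - k) b | k <- iota 1 a] ++
  [seq pos a (b - k) | k <- iota 1 b] ++
  [seq pos (a - k) (b - k) | k <- iota 1 a] ++
  [seq pos (a - k) (b - l) | k <- iota 1 a, l <- iota 0 k].

Lemma optionsP p q : q \in options p <-> move p q.
Proof.
have le_ab : smaller p <= larger p by exact: (valP p).
rewrite /options; set a := smaller p in le_ab *; set b := larger p in le_ab *.
have def_p : p = pos a b by rewrite posK.
split.
- rewrite !mem_cat; case/or4P.
  + case/mapP => k; rewrite mem_iota add1n ltnS => /andP[k1 ka] ->.
    by exists a, b; split=> //; constructor 1; exists k.
  + case/mapP => k; rewrite mem_iota add1n ltnS => /andP[k1 kb] ->.
    exists b, a; split; first by rewrite posC.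
    by constructor 1; exists k; split=> //; rewrite posC.
  + case/mapP => k; rewrite mem_iota add1n ltnS => /andP[k1 ka] ->.
    exists a, b; split=> //; constructor 2; exists k; split=> //.
    exact: leq_trans le_ab.
  + case/allpairsPdep => k [l []].
    rewrite !mem_iota add1n ltnS => /andP[k1 ka] /= lk ->.
    exists a, b; split=> //; constructor 3; split=> //; exists k, l; split=> //.
    exact: leq_trans (ltnW lk) (leq_trans ka le_ab).
- case=> x [y [def_p' mv]].
  have [] : (a = x /\ b = y) \/ (a = y /\ b = x).
    rewrite /a /b def_p' /smaller /larger /=.
    by case: (leqP x y) => [?|/ltnW ?]; [left|right].
  + case=> ax yb; rewrite -ax -yb in mv; case: mv.
    * case=> k [k1 ka ->]; rewrite !mem_cat; apply/or4P; constructor 1.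
      by apply/mapP; exists k; rewrite // mem_iota k1 add1n ltnS.
    * case=> k [k1 ka kb ->]; rewrite !mem_cat.
      apply/or4P; constructor 3; apply/mapP; exists k => //.
      by rewrite mem_iota k1 add1n ltnS.
    * case=> _ [k [l [k1 ka lk lb ->]]]; rewrite !mem_cat.
      apply/or4P; constructor 4; apply/allpairsPdep; exists k, l.
      by rewrite !mem_iota k1 add1n ltnS.
  + case=> ay bx; rewrite -ay -bx in mv; case: mv.
    * case=> k [k1 kb ->]; rewrite !mem_cat posC.
      apply/or4P; constructor 2; apply/mapP; exists k => //.
      by rewrite mem_iota k1 add1n ltnS.
    * case=> k [k1 kb ka ->]; rewrite !mem_cat posC.
      apply/or4P; constructor 3; apply/mapP; exists k => //.
      by rewrite mem_iota k1 add1n ltnS.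
    * case=> le_ba [k [l [k1 kb lk la ->]]]; rewrite !mem_cat.
      have eq_ab : a = b by apply/eqP; rewrite eqn_leq le_ab.
      apply/or4P; constructor 4; apply/allpairsPdep; exists k, l.
      by rewrite !mem_iota k1 add1n ltnS eq_ab.
Qed.

Lemma move_tokens p q : move p q -> tokens q < tokens p.
Proof.
have ltB x k : 1 <= k -> k <= x -> x - k < x.
  by move=> k1 kx; rewrite ltn_subrL k1 (leq_trans k1 kx).
case=> x [y [-> ]]; rewrite tokens_pos => -[].
- by case=> k [k1 kx ->]; rewrite tokens_pos ltn_add2r ltB.
- case=> k [k1 kx ky ->]; rewrite tokens_pos -addSn.
  by rewrite leq_add ?leq_subr ?ltB.
- case=> _ [k [l [k1 kx _ _ ->]]]; rewrite tokens_pos -addSn.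
  by rewrite leq_add ?leq_subr ?ltB.
Qed.

Lemma mex_subproof (s : seq nat) : exists n, n \notin s.
Proof.
exists (\max_(i <- s) i).+1; apply/negP => in_s.
have := @leq_bigmax_seq _ s xpredT (fun i : nat => i) _ in_s isT.
by rewrite ltnn.
Qed.

Definition mex (s : seq nat) : nat := ex_minn (mex_subproof s).

Fixpoint grundy_rec (n : nat) (p : position) : nat :=
  if n is m.+1 then mex [seq grundy_rec m q | q <- options p] else 0.

(* Every move removes a token, so [(tokens p).+1] levels of recursion suffice;
   [grundyE] is the defining equation. *)
Definition grundy (p : position) : nat := grundy_rec (tokens p).+1 p.

Lemma grundy_rec_stable n p : tokens p < n -> grundy_rec n p = grundy p.
Proof.
rewrite /grundy; elim/ltn_ind: n p => -[//|n] IHn p; rewrite ltnS => le_pn /=.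
congr mex; apply/eq_in_map => q /optionsP /move_tokens lt_qp.
rewrite IHn ?(leq_trans lt_qp) //.
case: (tokens p) lt_qp le_pn => // t lt_qt lt_tn.
by rewrite IHn.
Qed.

Lemma grundyE p : grundy p = mex [seq grundy q | q <- options p].
Proof.
rewrite {1}/grundy /=; congr mex; apply/eq_in_map => q /optionsP/move_tokens.
exact: grundy_rec_stable.
Qed.

(* Main.v *)
Require Import Defs.
From mathcomp Require Import all_boot all_order all_algebra zify.

Set Implicit Arguments.
Unset Strict Implicit.
Unset Printing Implicit Defensive.

Import Order.TTheory GRing.Theory Num.Theory.
Local Open Scope ring_scope.

(** Suppose [v = G(a, b)] with [b >= v + 2a], and take [b] least for this [a].
    Minimality and the move from [(a, b)] to [(a, b - 1)] give [G(a, b - 1) > v],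
    so [(a, b - 1)] has an option [(i, c)] of value [v], and [i < a] since
    otherwise it would also be an option of [(a, b)].  A move lowering the smaller
    pile by [a - i] lowers the larger one by at most [a - i], so
    [c >= b - 1 - (a - i)], and for [i >= 3] induction on [a] gives
    [v >= c - 2i + 1 >= b - 2a + 1], a contradiction.  The bound fails on rows [0]
    and [1]; rows [0], [1], [2] are computed explicitly, and there
    [G(i, c) >= c - i - 1], which still exceeds [v]. *)

(** All moves that lower the smaller pile merge into one case: with [k = a - i] taken from it, the
    larger pile loses some [l] with [0 <= l <= k], where [l = k] is the diagonal move. *)
Lemma move_posP a b q : (a <= b)%N ->
  move (pos a b) q <->
  exists i c, q = pos i c /\
    ((i = a /\ c < b)%N \/ (i < a /\ c <= b <= c + (a - i))%N).
Proof.
move=> ab; rewrite -optionsP /options smaller_pos // larger_pos // !mem_cat.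
split.
- case/or4P.
  + by case/mapP => k; rewrite mem_iota => hk ->; exists (a - k)%N, b; split=> //; lia.
  + by case/mapP => k; rewrite mem_iota => hk ->; exists a, (b - k)%N; split=> //; lia.
  + case/mapP => k; rewrite mem_iota => hk ->.
    by exists (a - k)%N, (b - k)%N; split=> //; lia.
  + case/allpairsPdep => k [l []]; rewrite !mem_iota => hk hl ->.
    by exists (a - k)%N, (b - l)%N; split=> //; lia.
- case=> i [c [-> [[-> cb]|[ia cb]]]]; apply/or4P.
  + constructor 2; apply/mapP; exists (b - c)%N; first by rewrite mem_iota; lia.
    by congr pos; lia.
  + have [eq_d|ne_d] := eqVneq (b - c)%N (a - i)%N.
      constructor 3; apply/mapP; exists (a - i)%N; first by rewrite mem_iota; lia.
      by congr pos; lia.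
    constructor 4; apply/allpairsPdep; exists (a - i)%N, (b - c)%N.
    by rewrite !mem_iota; split; [lia|lia|congr pos; lia].
Qed.

Lemma move_row a b c : (a <= b)%N -> (c < b)%N -> move (pos a b) (pos a c).
Proof. by move=> ab cb; apply/(move_posP _ ab); exists a, c; split; [|left]. Qed.

Lemma move_below a b i c : (a <= b)%N -> (i < a)%N -> (c <= b <= c + (a - i))%N ->
  move (pos a b) (pos i c).
Proof.
by move=> ab ia cb; apply/(move_posP _ ab); exists i, c; split; [|right].
Qed.

Lemma grundy_move p q : move p q -> grundy q <> grundy p.
Proof.
move=> /optionsP pq; rewrite [grundy p]grundyE /mex.
by case: ex_minnP => m /negP m_notin _ eq_m; apply/m_notin/mapP; exists q.
Qed.

Lemma grundy_lt p u : (u < grundy p)%N -> exists q, move p q /\ grundy q = u.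
Proof.
rewrite grundyE /mex; case: ex_minnP => m _ min_m lt_um.
have /mapP[q /optionsP pq ->] : u \in [seq grundy q | q <- options p].
  by apply: contraLR lt_um => /min_m; rewrite -leqNgt.
by exists q.
Qed.

Lemma grundy_eq p v : (forall q, move p q -> grundy q <> v) ->
  (forall u, (u < v)%N -> exists q, move p q /\ grundy q = u) -> grundy p = v.
Proof.
move=> not_v below_v; case: (ltngtP (grundy p) v) => // [lt_pv|/grundy_lt[q [pq]]].
  by have [q [/grundy_move]] := below_v _ lt_pv.
by move/not_v: pq.
Qed.

Lemma grundy_row0 b : grundy (pos 0 b) = b.
Proof.
elim/ltn_ind: b => b IHb; apply: grundy_eq => [q|u ub].
  move/(move_posP _ (leq0n b)) => [i [c [-> [[-> cb]|]]]]; last lia.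
  by rewrite IHb //; lia.
by exists (pos 0 u); split; [exact: move_row|exact: IHb].
Qed.

(** A cyclic shift on each block [3m, 3m + 1, 3m + 2]. *)
Definition row1 b := (if b %% 3 == 2 then b - 2 else b + 1)%N.

Lemma grundy_row1 b : grundy (pos 1 b) = row1 b.
Proof.
elim/ltn_ind: b => -[|b] IHb; first by rewrite posC grundy_row0.
have b1 : (1 <= b.+1)%N by [].
apply: grundy_eq => [q|u].
  move/(move_posP _ b1) => [i [c [-> [[-> cb]|[i1 cb]]]]].
    by rewrite IHb // /row1; do ?case: ifP; lia.
  have -> : i = 0%N by lia.
  by rewrite grundy_row0 /row1; do ?case: ifP; lia.
move=> ub; have [u_col0|u_row] := boolP (b <= u <= b.+1)%N.
  exists (pos 0 u); split; last exact: grundy_row0.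
  by apply: move_below => //; lia.
(* The values [b] and [b + 1] came from row 0; any other [u] comes from row 1, at its preimage [c]
   under [row1]. *)
pose c := (if u %% 3 == 0 then u + 2 else u - 1)%N.
have cb : (c < b.+1)%N by move: ub; rewrite /row1 /c; do ?case: ifP; lia.
exists (pos 1 c); split; first exact: move_row.
by rewrite IHb // /row1 /c; do ?case: ifP; lia.
Qed.

(** At [b = 1] the truncated [b - 3] gives the correct value 0. *)
Definition row2 b :=
  (if b %% 3 == 0 then b + 2 else if b %% 3 == 1 then b - 3 else b + 1)%N.

Lemma grundy_row2 b : grundy (pos 2 b) = row2 b.
Proof.
elim/ltn_ind: b => -[|[|b]] IHb; first by rewrite posC grundy_row0.
  by rewrite posC grundy_row1.
have b2 : (2 <= b.+2)%N by [].
apply: grundy_eq => [q|u].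
  move/(move_posP _ b2) => [i [c [-> [[-> cb]|[i2 cb]]]]].
    by rewrite IHb // /row2; do ?case: ifP; lia.
  case: i i2 cb => [|[|//]] _ cb;
    rewrite ?grundy_row0 ?grundy_row1 /row1 /row2; do ?case: ifP; lia.
move=> ub; have [u_col0|u_col0] := boolP (b <= u <= b.+2)%N.
  exists (pos 0 u); split; last exact: grundy_row0.
  by apply: move_below => //; lia.
(* [b + 3] is below [row2 b.+2] only if 3 divides [b + 2], and then it equals [row1 b.+2]. *)
have [u_col1|u_col1] := eqVneq u b.+3.
  exists (pos 1 b.+2); split; first by apply: move_below => //; lia.
  by move: ub; rewrite grundy_row1 u_col1 /row1 /row2; do ?case: ifP; lia.
(* The preimage of [u] under [row2]; truncation makes [u = 0] a separate case. *)
pose c := (if u == 0 then 1 else if u %% 3 == 0 then u - 1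
           else if u %% 3 == 1 then u + 3 else u - 2)%N.
have cb : (c < b.+2)%N by move: ub; rewrite /row2 /c; do ?case: ifP; lia.
exists (pos 2 c); split; first exact: move_row.
rewrite IHb // /row2 /c; case: (eqVneq u 0%N) => [->|u_neq0] //.
by do ?case: ifP; lia.
Qed.

Lemma grundy_lower_bound a b : (3 <= a)%N -> (a <= b)%N ->
  (b < grundy (pos a b) + 2 * a)%N.
Proof.
elim/ltn_ind: a b => a IHa b a3; elim/ltn_ind: b => b IHb ab.
case: ltnP => // le_vb; set v := grundy _ in le_vb.
have ab1 : (a <= b.-1)%N by lia.
have b1b : (b.-1 < b)%N by lia.
have /eqP w_neq_v : grundy (pos a b.-1) <> v by exact: grundy_move (move_row _ _).
have /grundy_lt[q [/(move_posP _ ab1)]] : (v < grundy (pos a b.-1))%N.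
  by have := IHb _ b1b ab1; lia.
case=> i [c [-> [[-> cb]|[ia cb]]]] q_v.
  by have := @grundy_move (pos a b) (pos a c) (move_row _ _ ); lia.
(* In rows 0 to 2 the value is at least [c - i - 1 >= b - a - 2], which exceeds [b - 2a >= v]
   because [a >= 3]. *)
case: i ia cb q_v => [|[|[|i]]] ia cb q_v.
- by move: q_v; rewrite grundy_row0; lia.
- by move: q_v; rewrite grundy_row1 /row1; do ?case: ifP; lia.
- by move: q_v; rewrite grundy_row2 /row2; do ?case: ifP; lia.
(* The pair is still sorted: [b >= 2a] puts [c] at or above the new smaller pile [i.+3]. *)
- by have := IHa _ ia c isT; lia.
Qed.

Theorem theorem3p7 (a b : nat) (ha : (3 <= a)%N) (hab : (a <= b)%N) :
  b%:Z - 2 * a%:Z + 1 <= (grundy (pos a b))%:Z.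
Proof. by have := grundy_lower_bound ha hab; lia. Qed.
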